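(* Let $\alpha\in(0,1)$ be irrational. Suppose there are a set $U\subset S^1$ which is a finite union of intervals with $m(U)=\tfrac12$ and a point $x\in S^1$ such that, with $f=2\chi_U-1$, the series $$\sum_{n=1}^\infty \frac{f(x+n\alpha)}{n}$$ diverges. Then $\alpha$ is a Liouville number. Hence the set of all irrational $\alpha\in(0,1)$ for which such $U$ and $x$ exist has Hausdorff dimension $0$.
   Context: $S^1=\mathbb{R}/\mathbb{Z}$, $m$ is Lebesgue measure on $S^1$ (normalized so $m(S^1)=1$), $\chi_U$ is the indicator function of $U$, and $x+n\alpha$ is taken mod $1$. An irrational real number $\alpha$ is a Liouville number if for every $v\ge 1$ there exists a rational number $\frac pq$ with integers $p,q$, $q\ge 2$, such that $\left|\alpha-\frac pq\right|<q^{-(v+1)}$. *)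

(* Defs.v *)
From HB Require Import structures.
From mathcomp Require Import all_boot all_order all_algebra.
From mathcomp Require Import generic_quotient ring_quotient.
From mathcomp Require Import all_classical all_reals all_analysis.

Set Implicit Arguments.
Unset Strict Implicit.
Unset Printing Implicit Defensive.

Import Order.TTheory GRing.Theory Num.Theory.
Import numFieldNormedType.Exports.

Local Open Scope classical_set_scope.
Local Open Scope ring_scope.
Local Open Scope quotient_scope.

Definition integers (R : realType) : zmodClosed R :=
  [the zmodClosed R of Num.int_num_subdef : {pred R}].

(* The group R/Z. Despite the name of the notation, the quotient of a zmodType
   by any subgroup is available, with its additive structure. *)
Definition circle (R : realType) : Type := {ideal_quot (integers R)}.

HB.instance Definition _ (R : realType) := Choice.on (circle R).
HB.instance Definition _ (R : realType) := GRing.Zmodule.on (circle R).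

Definition to_circle (R : realType) (t : R) : circle R :=
  \pi_({ideal_quot (integers R)}) t.

(* `[0, 1[ is a fundamental domain of the projection, so this is the
   normalized Lebesgue measure on Borel sets. *)
Definition circle_measure (R : realType) (U : set (circle R)) : \bar R :=
  lebesgue_measure (`[0, 1[ `&` @to_circle R @^-1` U).

(* An interval of the circle is the projection of an interval of the line;
   open, closed, half-open and degenerate intervals are all allowed, and an
   arc may contain the class of 0 in its interior. *)
Definition finite_union_of_arcs (R : realType) (U : set (circle R)) : Prop :=
  exists s : seq (interval R),
    U = \big[setU/set0]_(i <- s) (@to_circle R @` [set` i]).

Definition balanced_indic (R : realType) (U : set (circle R)) : circle R -> R :=
  fun y => 2 * \1_U y - 1.

Definition rotation_sums (R : realType) (U : set (circle R)) (x : circle R)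
    (alpha : R) : R^nat :=
  fun N => \sum_(1 <= n < N.+1)
             balanced_indic U (x + to_circle (n%:R * alpha)) / n%:R.

Definition liouville (R : realType) (alpha : R) : Prop :=
  irrational alpha /\
  forall v : R, 1 <= v ->
    exists p q : int, 2 <= q /\
      `|alpha - p%:~R / q%:~R| < (q%:~R : R) `^ (- (v + 1)).

(* The [maxe 0] only matters for the empty set, where the supremum is -oo. *)
Definition diameter (R : realType) (E : set R) : \bar R :=
  maxe 0%E (ereal_sup [set `|z.1 - z.2|%:E | z in E `*` E]).

(* [0 `^ 0 = 1] in the library, so the empty set has to be singled out for
   the 0-dimensional measure to be the counting measure. *)
Definition diam_pow (R : realType) (s : R) (E : set R) : \bar R :=
  if E == set0 then 0%E else (diameter E `^ s)%E.

Definition hausdorff_content (R : realType) (s delta : R) (A : set R) : \bar R :=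
  ereal_inf [set (\sum_(0 <= i <oo) diam_pow s (F i))%E | F in
    [set F : (set R)^nat | A `<=` \bigcup_i F i /\
                           forall i, (diameter (F i) <= delta%:E)%E]].

Definition hausdorff_measure (R : realType) (s : R) (A : set R) : \bar R :=
  ereal_sup [set hausdorff_content s delta A | delta in [set d : R | 0 < d]].

Definition hausdorff_dim (R : realType) (A : set R) : \bar R :=
  ereal_inf [set s%:E | s in
    [set s : R | 0 <= s /\ hausdorff_measure s A = 0%E]].

(* Main.v *)
Require Import Defs.
From HB Require Import structures.
From mathcomp Require Import all_boot all_order all_algebra.
From mathcomp Require Import generic_quotient ring_quotient.
From mathcomp Require Import all_classical all_reals all_analysis.
From mathcomp Require Import zify ring lra.

(** For a balanced finite union of arcs [U] put [f = 2 \1_U - 1], so that the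
    values of [f] are [1] and [-1] and its mean is [0].

    Convergence for non-Liouville rotation numbers.  Let [q] be a denominator
    with [|q alpha - p| <= 1/q] and [p, q] coprime.  Then [q] consecutive points
    of the orbit visit the [q] cells [[i/q, (i+1)/q)] of the circle once each, up
    to an error of one cell.  The indicator of [U] only jumps at the endpoints of
    the arcs, so all but boundedly many cells see no jump; counting over the other
    cells shows that the sum of [f] over such a block is bounded by a constant
    which depends on [U] only ([orbit_visits_ge], [block_sum_bounded]).  If
    [alpha] is not Liouville, then [|q alpha - p| >= 1/(A q^m)] for all [p, q],
    and Dirichlet's theorem at level [A K^m] provides a denominator [q] between
    [K] and [A K^m]; cutting [N] points into blocks of length [q] gives
    [|S_N| <= B N / K] whenever [N >= K^(m+1)] ([orbit_sum_growth]).  The partial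
    sums [S_N] are thus of order [N^(1-1/(m+1))], and Abel summation turns this
    saving of a power into convergence of the series with weights [1/n]
    ([cvg_harmonic_weighted_sum]).

    Dimension of the Liouville numbers.  For every [n], a Liouville number in
    [(0,1)] lies within [q^-n] of some [p/q] with [2 <= q] and [0 <= p <= q].
    For fixed [s > 0] the sum of the [s]-th powers of the diameters of these balls
    tends to [0] as [n] grows, so every Hausdorff measure of positive exponent
    vanishes ([hausdorff_measure_liouville_subset]). *)

Import Order.TTheory GRing.Theory Num.Theory.
Import numFieldNormedType.Exports.

Local Open Scope classical_set_scope.
Local Open Scope ring_scope.

(** * The circle and finite unions of arcs *)

Lemma to_circleD (R : realType) (s t : R) :
  to_circle (s + t) = to_circle s + to_circle t.
Proof. exact: (raddfD (\pi_({ideal_quot (integers R)})%qT)). Qed.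

Lemma to_circle_eqP (R : realType) (s t : R) :
  to_circle s = to_circle t <-> exists k : int, s = t + k%:~R.
Proof.
have -> : to_circle s = to_circle t <-> s - t \is a Num.int.
  rewrite -[X in _ <-> is_true X]/(s - t \in integers R) Quotient.idealrBE.
  by split=> [/eqP|/eqP].
split=> [/intrP[k hk]|[k ->]].
  by exists k; rewrite -hk addrC subrK.
by apply/intrP; exists k; rewrite addrAC subrr add0r.
Qed.

Lemma to_circle_surj (R : realType) (x : circle R) : exists t, to_circle t = x.
Proof. by exists (repr x); exact: reprK. Qed.

(** The set has no jump away from the integer translates of [E].  In this form
    the property passes to complements, so that one counting inequality applied to
    a set and to its complement bounds the number of visits from both sides. *)
Definition constant_off_shifts (R : realType) (E : seq R) (W : set R) : Prop :=
  forall a b : R, (forall (e : R) (k : int), e \in E -> ~ a < e + k%:~R < b) ->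
  forall u v, a < u < b -> a < v < b -> W u -> W v.

Lemma constant_off_shifts_setC (R : realType) (E : seq R) (W : set R) :
  constant_off_shifts R E W -> constant_off_shifts R E (~` W).
Proof. by move=> h a b hE u v hu hv nWu Wv; apply: nWu; exact: (h a b hE v u). Qed.

Lemma constant_off_shifts_setU (R : realType) (E1 E2 : seq R) (W1 W2 : set R) :
  constant_off_shifts R E1 W1 -> constant_off_shifts R E2 W2 ->
  constant_off_shifts R (E1 ++ E2) (W1 `|` W2).
Proof.
move=> h1 h2 a b hE u v hu hv [W|W]; [left|right].
  by apply: (h1 a b _ u v) => // e k he; apply: hE; rewrite mem_cat he.
by apply: (h2 a b _ u v) => // e k he; apply: hE; rewrite mem_cat he orbT.
Qed.

Definition finite_bound (R : realType) (b : itv_bound R) : seq R :=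
  if b is BSide _ e then [:: e] else [::].

Lemma preimage_arcE (R : realType) (I : interval R) :
  @to_circle R @^-1` (@to_circle R @` [set` I]) =
  \bigcup_(k in [set: int]) [set u | u - k%:~R \in I].
Proof.
apply/seteqP; split=> u /=.
  case=> t It /esym /to_circle_eqP[k ->]; exists k => //=.
  by rewrite addrK.
case=> k _ /= uI; exists (u - k%:~R) => //.
by apply/esym/to_circle_eqP; exists k; rewrite subrK.
Qed.

(** An interval without endpoints of [I + k] inside is contained in [I + k] or
    disjoint from it. *)
Lemma constant_off_shifts_arc (R : realType) (I : interval R) :
  constant_off_shifts R (finite_bound R I.1 ++ finite_bound R I.2)
    (@to_circle R @^-1` (@to_circle R @` [set` I])).
Proof.
rewrite preimage_arcE => a b hE u v /andP[au ub] /andP[av vb] [k _ /= uI].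
exists k => //=; move: uI hE; case: I => l r; rewrite !itv_boundlr /=.
move=> /andP[lu ur] hE; apply/andP; split.
  case: l lu hE => [s e|//] lu hE.
  have /negP := hE e k (mem_head _ _).
  by case: s lu {hE}; rewrite !bnd_simp => lu; lra.
case: r ur hE => [s e|//] ur hE.
have /negP : ~ a < e + k%:~R < b by apply: hE; rewrite mem_cat mem_head orbT.
by case: s ur {hE}; rewrite !bnd_simp => ur; lra.
Qed.

Lemma measurable_preimage_arc (R : realType) (I : interval R) :
  measurable (@to_circle R @^-1` (@to_circle R @` [set` I]) : set R).
Proof.
rewrite preimage_arcE; apply: countable_bigcupT_measurable => [|k]; first exact: countableP.
rewrite -[X in measurable X]setTI.
have mf : measurable_fun [set: R] (fun u : R => u - k%:~R).
  by exact: measurable_realfun.measurable_funB.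
exact: (mf measurableT [set` I] (measurable_itv I)).
Qed.

Lemma finite_union_of_arcs_preimage (R : realType) (U : set (circle R)) :
  finite_union_of_arcs U ->
  measurable (@to_circle R @^-1` U : set R) /\
  exists E, constant_off_shifts R E (@to_circle R @^-1` U).
Proof.
case=> s ->; elim: s => [|I s [mU [E hE]]].
  by rewrite big_nil preimage_set0; split=> //; exists [::] => a b _ u v.
rewrite big_cons preimage_setU; split.
  by apply: measurableU => //; exact: measurable_preimage_arc.
exists ((finite_bound R I.1 ++ finite_bound R I.2) ++ E).
by apply: constant_off_shifts_setU => //; exact: constant_off_shifts_arc.
Qed.

(** * Orbit counting in cells *)

Definition residue (n : nat) (z : int) : 'I_n.+1 := inord `|(z %% n.+1)%Z|%N.

Lemma residueE (n : nat) (z : int) : (residue n z : int) = (z %% n.+1)%Z.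
Proof.
have z0 : (0 <= z %% n.+1)%Z by rewrite modz_ge0.
have zn : (z %% n.+1)%Z < n.+1 by rewrite ltz_pmod.
by rewrite /residue inordK; lia.
Qed.

Lemma residueP (n : nat) (i : 'I_n.+1) (z : int) :
  i = residue n z <-> exists k : int, z = i%:Z + k * n.+1%:Z.
Proof.
split=> [->|[k ->]].
  by exists (z %/ n.+1)%Z; rewrite residueE {1}(divz_eq z n.+1) addrC.
apply/val_inj/eqP; rewrite -eqz_nat residueE addrC modzMDl.
by rewrite modz_small ?eqxx //; have := ltn_ord i; lia.
Qed.

(** The orbit of a rotation by [p/q] in lowest terms meets each residue once. *)
Lemma residue_linear_inj (n : nat) (p c : int) : coprimez n.+1 p ->
  injective (fun j : 'I_n.+1 => residue n (c + j%:Z * p)).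
Proof.
move=> cop j1 j2 /residueP[k hk].
have /residueP[k' hk'] : residue n (c + j1%:Z * p) = residue n (c + j1%:Z * p) by [].
have : (n.+1 %| (j1%:Z - j2%:Z) * p)%Z.
  by apply/dvdzP; exists (k' - k); rewrite !mulrBl; lia.
rewrite Gauss_dvdzl // => /dvdzP[d hd].
apply: val_inj; have := ltn_ord j1; have := ltn_ord j2 => /=.
move: (nat_of_ord j1) (nat_of_ord j2) hd => a b hd bn an.
have d1 : d < 1 by rewrite ltNge; apply/negP => d1; nia.
have d2 : -1 < d by rewrite ltNge; apply/negP => d2; nia.
have d0 : d = 0 by lia.
rewrite d0 in hd; lia.
Qed.

(** The cells [[i/q, (i+1)/q)] that meet [W] cover its part in [[0, 1)], and
    each has measure [1/q]. *)
Lemma measure_le_cells (R : realType) (W : set R) (n : nat) :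
  measurable W ->
  (lebesgue_measure (`[0%R, 1%R[ `&` W) <=
   (#|[set i : 'I_n.+1 | `[< exists2 u, W u & i%:R <= n.+1%:R * u < i.+1%:R >]]%SET|%:R
      / n.+1%:R)%:E)%E.
Proof.
move=> mW; set A := [set i | _]%SET.
pose C (i : nat) : set R :=
  if `[< exists2 u, W u & i%:R <= n.+1%:R * u < i.+1%:R >]
  then `[i%:R / n.+1%:R, i.+1%:R / n.+1%:R[%classic else set0.
have mC i : measurable (C i).
  by rewrite /C; case: ifP => _ //; exact: measurable_itv.
have n0 : 0 < n.+1%:R :> R by rewrite ltr0n.
have sub : `[0, 1[ `&` W `<=` \big[setU/set0]_(i < n.+1) C i.
  move=> u [/=]; rewrite in_itv/= => /andP[u0 u1] Wu.
  have qu0 : 0 <= n.+1%:R * u by rewrite mulr_ge0 // ltW.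
  have /andP[h1 h2] := truncn_itv qu0.
  have tn : (Num.truncn (n.+1%:R * u) < n.+1)%N.
    rewrite -(ltr_nat R); apply: le_lt_trans h1 _.
    by rewrite gtr_pMr.
  rewrite -bigcup_mkord; exists (Num.truncn (n.+1%:R * u)) => //=.
  rewrite /C ifT; last by apply/asboolP; exists u => //; apply/andP.
  by rewrite /= in_itv/= ler_pdivrMr // ltr_pdivlMr // [u * _]mulrC h1 h2.
apply: (@le_trans _ _ (lebesgue_measure (\big[setU/set0]_(i < n.+1) C i))).
  apply: le_measure => //; rewrite inE.
    by apply: measurableI => //; exact: measurable_itv.
  by apply: bigsetU_measurable => i _; exact: mC.
apply: le_trans (Boole_inequality _ _) _; first by move=> i _; exact: mC.
have -> : (#|A|%:R / n.+1%:R)%:E =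
    (\sum_(i < n.+1) (if i \in A then n.+1%:R^-1 else 0 : R)%:E)%E.
  by rewrite sumEFin -big_mkcond /= sumr_const mulr_natl.
apply: lee_sum => i _; rewrite /A inE /C; case: ifP => _; last by rewrite measure0.
have cell_measure : lebesgue_measure (`[i%:R / n.+1%:R, i.+1%:R / n.+1%:R[%classic : set R) =
    (n.+1%:R^-1)%:E.
  rewrite lebesgue_measure_itv /= ifT.
    by rewrite -EFinB -mulrBl -natrB // subSnn mul1r.
  by rewrite lte_fin ltr_pM2r ?invr_gt0 // ltr_nat.
by rewrite le_eqVlt; apply/orP; left; apply/eqP; exact: cell_measure.
Qed.

(** The point [s + j alpha] lies within one cell of the cell numbered
    [floor (q s) + j p] modulo [q], and these numbers run once through all
    residues.  If the cell meets [W] and no jump of [W] is within one cell of it,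
    then the point itself is in [W].  A jump [e] spoils at most the three cells
    around it, hence the error [3 * size E]. *)
Lemma orbit_visits_ge (R : realType) (E : seq R) (W : set R) (n : nat) (p : int)
    (alpha s m : R) :
  measurable W -> constant_off_shifts R E W ->
  (forall u (k : int), W u -> W (u + k%:~R)) ->
  coprimez n.+1 p -> `|n.+1%:R * alpha - p%:~R| <= n.+1%:R^-1 ->
  lebesgue_measure (`[0, 1[ `&` W) = m%:E ->
  n.+1%:R * m <=
    #|[set j : 'I_n.+1 | `[< W (s + j%:R * alpha) >]]%SET|%:R + (3 * size E)%:R.
Proof.
move=> mW cW pW cop approx Wm.
set J := [set j | _]%SET.
have n0 : 0 < n.+1%:R :> R by rewrite ltr0n.
have := measure_le_cells R W n mW; rewrite Wm lee_fin ler_pdivlMr // mulrC.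
set A := [set i | _]%SET => /le_trans; apply.
(* If a translate of [e] lies within one cell of the cell [i], then [i] is one of
   [floor (q e) - 1], [floor (q e)], [floor (q e) + 1] modulo [q]. *)
pose near_endpoint : {set 'I_n.+1} := [set i in
  [seq residue n (Num.floor (n.+1%:R * e) - 1 + r%:Z) | e <- E, r <- iota 0 3]]%SET.
pose f := fun j : 'I_n.+1 => residue n (Num.floor (n.+1%:R * s) + j%:Z * p).
have finj : injective f by exact: residue_linear_inj.
rewrite -natrD ler_nat.
have card_near : (#|near_endpoint| <= 3 * size E)%N.
  rewrite /near_endpoint cardsE; apply: leq_trans (card_size _) _.
  by rewrite size_allpairs size_iota mulnC.
have AJ : (#|A :\: near_endpoint| <= #|J|)%N.
  (* [f j] is the cell that the [j]-th point of the block is close to. *)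
  rewrite -(on_card_preimset (f := f)); last first.
    by apply: onW_bij; exact: injF_bij finj.
  apply/subset_leq_card/fintype.subsetP => j.
  rewrite !inE => /andP[far /asboolP[u Wu /andP[u1 u2]]].
  have /residueP[k hk] : f j = residue n (Num.floor (n.+1%:R * s) + j%:Z * p) by [].
  move: (f j) far u1 u2 hk => i far u1 u2 hk.
  have fl := floor_itv (n.+1%:R * s).
  have hkR : (Num.floor (n.+1%:R * s))%:~R + j%:R * p%:~R =
      i%:R + k%:~R * n.+1%:R :> R.
    by have := congr1 (fun z : int => z%:~R : R) hk; rewrite !rmorphD !rmorphM /=.
  rewrite -[X in W X](subrK k%:~R); apply: (pW _ k).
  have err : `|j%:R * (n.+1%:R * alpha - p%:~R)| < 1.
    rewrite normrM ger0_norm //.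
    apply: le_lt_trans (ler_wpM2l _ approx) _ => //.
    by rewrite ltr_pdivrMr // mul1r ltr_nat.
  apply: (cW ((i%:R - 1) / n.+1%:R) ((i%:R + 2) / n.+1%:R) _ u) => //; last first.
  - rewrite ltr_pdivrMr // ltr_pdivlMr //.
    move: err fl; rewrite ltr_norml intrD => /andP[e1 e2] /andP[f1 f2].
    by apply/andP; split; nra.
  - rewrite ltr_pdivrMr // ltr_pdivlMr //.
    by move: u1 u2; rewrite -natr1 => u1 u2; apply/andP; split; nra.
  move=> e l eE; rewrite ltr_pdivrMr // ltr_pdivlMr // => /andP[e1 e2].
  move/negP: far; apply.
  have fe := floor_itv (n.+1%:R * e).
  pose z := i%:Z - l * n.+1%:Z - (Num.floor (n.+1%:R * e) - 1).
  have zR : (z%:~R : R) = i%:R - l%:~R * n.+1%:R - ((Num.floor (n.+1%:R * e))%:~R - 1).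
    by rewrite /z !rmorphB /= rmorphM /=.
  have z0 : -1 < z.
    by rewrite -(ltr_int R) zR rmorphN1; move: fe; rewrite intrD => /andP[f1 f2]; nra.
  have z3 : z < 3.
    by rewrite -(ltr_int R) zR; move: fe; rewrite intrD => /andP[f1 f2]; nra.
  apply/allpairsP; exists (e, `|z|%N) => /=; split=> //.
    by rewrite !inE; lia.
  have absz : (`|z|%N : int) = z by lia.
  apply/residueP; exists (- l); rewrite absz /z; ring.
rewrite -(cardsID near_endpoint A) addnC leq_add //.
by apply: leq_trans card_near; rewrite subset_leq_card // finset.subsetIr.
Qed.

(** * Dirichlet approximation *)

(** Pigeonhole on the fractional parts of the first [Q + 1] multiples of
    [alpha]; dividing by the gcd does not worsen the approximation. *)
Lemma dirichlet_approximation (R : realType) (alpha : R) (Q : nat) : (0 < Q)%N ->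
  exists (n : nat) (p : int), [/\ (n.+1 <= Q)%N, coprimez n.+1 p &
    `|n.+1%:R * alpha - p%:~R| < Q%:R^-1].
Proof.
case: Q => // Q _.
have Q0 : 0 < Q.+1%:R :> R by rewrite ltr0n.
pose frac (j : nat) := j%:R * alpha - (Num.floor (j%:R * alpha))%:~R.
have frac01 j : 0 <= frac j < 1.
  have := floor_itv (j%:R * alpha); rewrite intrD /frac => /andP[? ?].
  by apply/andP; split; lra.
pose box (j : 'I_Q.+2) : 'I_Q.+1 := inord (Num.truncn (Q.+1%:R * frac j)).
have boxP j : (box j)%:R <= Q.+1%:R * frac j < (box j).+1%:R.
  have /andP[f0 f1] := frac01 j.
  have qf0 : 0 <= Q.+1%:R * frac j by rewrite mulr_ge0 // ltW.
  have /andP[h1 h2] := truncn_itv qf0.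
  rewrite /box inordK ?h1 ?h2 // -(ltr_nat R); apply: le_lt_trans h1 _.
  by rewrite gtr_pMr.
have : ~ injective box by move=> /leq_card; rewrite !card_ord ltnn.
move=> /injectiveP /injectivePn[j1 [j2 j12 eqbox]].
wlog lt12 : j1 j2 j12 eqbox / (j1 < j2)%N.
  move=> H; case: (ltngtP j1 j2) j12 => h j12; [exact: (H j1 j2)| |].
    by apply: (H j2 j1) => //; rewrite eq_sym.
  by rewrite (val_inj h) eqxx in j12.
pose q := (j2 - j1)%N.
pose p := Num.floor (j2%:R * alpha) - Num.floor (j1%:R * alpha).
have q0 : (0 < q)%N by rewrite subn_gt0.
have qQ : (q <= Q.+1)%N by rewrite /q; have := ltn_ord j2; lia.
have approx : `|q%:R * alpha - p%:~R| < Q.+1%:R^-1.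
  have -> : q%:R * alpha - p%:~R = frac j2 - frac j1.
    by rewrite /q natrB 1?ltnW // /p intrB /frac; ring.
  rewrite -[ltRHS]mul1r ltr_pdivlMr // -[X in _ * X]gtr0_norm // -normrM.
  have := boxP j1; have := boxP j2; rewrite eqbox -natr1 => /andP[a1 a2] /andP[a3 a4].
  by rewrite ltr_norml; apply/andP; split; lra.
pose g := gcdn q `|p|%N.
have g0 : (0 < g)%N by rewrite gcdn_gt0 q0.
have [q' hq] : exists q', q = (q' * g)%N by apply/dvdnP; exact: dvdn_gcdl.
have [p' hp] : exists p', p = p' * g%:Z by apply/dvdzP; rewrite dvdzE /= dvdn_gcdr.
have q'0 : (0 < q')%N by move: q0; rewrite hq muln_gt0 => /andP[].
exists q'.-1, p'; rewrite prednK //; split.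
- by apply: leq_trans qQ; rewrite hq leq_pmulr.
- rewrite /coprimez /gcdz eqz_nat /= -(eqn_pmul2r g0) mul1n muln_gcdl -hq.
  by rewrite -[g in X in gcdn q X]absz_nat -abszM -hp.
apply: le_lt_trans approx; rewrite hq hp natrM intrM.
have -> : q'%:R * g%:R * alpha - p'%:~R * g%:~R = g%:R * (q'%:R * alpha - p'%:~R).
  by rewrite -pmulrn; ring.
by rewrite normrM ger0_norm // ler_peMl // ler1n.
Qed.

(** * Sums along one block of the orbit *)

Lemma balanced_indic_to_circle (R : realType) (U : set (circle R)) (u : R) :
  balanced_indic U (to_circle u) = if `[< U (to_circle u) >] then 1 else -1.
Proof.
rewrite /balanced_indic indicE; case: asboolP => h.
  by rewrite mem_set //=; lra.
by rewrite memNset //=; lra.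
Qed.

Lemma norm_balanced_indic (R : realType) (U : set (circle R)) (x : circle R) :
  `|balanced_indic U x| = 1.
Proof.
have [u <-] := to_circle_surj R x.
by rewrite balanced_indic_to_circle; case: ifP; rewrite ?normrN normr1.
Qed.

(** Both [U] and its complement have measure [1/2], so both are visited at least
    [q/2 - 3 #E] times by a block of length [q], where [E] lists the endpoints. *)
Lemma block_sum_bounded (R : realType) (U : set (circle R)) :
  finite_union_of_arcs U -> circle_measure U = (2^-1)%:E ->
  exists C : nat, forall (n : nat) (p : int) (alpha s : R),
    coprimez n.+1 p -> `|n.+1%:R * alpha - p%:~R| <= n.+1%:R^-1 ->
    `|\sum_(j < n.+1) balanced_indic U (to_circle (s + j%:R * alpha))| <= C%:R.
Proof.
move=> /finite_union_of_arcs_preimage[mV [E cV]] mU.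
set V := @to_circle R @^-1` U in mV cV.
have pV (W : set (circle R)) u (k : int) :
    (@to_circle R @^-1` W) u -> (@to_circle R @^-1` W) (u + k%:~R).
  have e : to_circle (u + k%:~R) = to_circle u by apply/to_circle_eqP; exists k.
  by rewrite /= e.
have mcV : lebesgue_measure (`[0, 1[ `&` ~` V) = (2^-1)%:E.
  have m01 : lebesgue_measure (`[0, 1[%classic : set R) = 1%E.
    by rewrite lebesgue_measure_itv /= lte_fin ltr01 sube0.
  have : (1 = lebesgue_measure (`[0%R, 1%R[ `&` ~` V) + (2^-1)%:E)%E.
    by rewrite -m01 -[in RHS]mU /circle_measure -setDE; exact: measureDI.
  case: lebesgue_measure => [r| |] //; rewrite -EFinD => -[] hr.
  by congr (_%:E); lra.
exists (6 * size E)%N => n p alpha s cop approx.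
have h1 := orbit_visits_ge R E V n p alpha s _ mV cV (pV U) cop approx mU.
have h2 := orbit_visits_ge R E (~` V) n p alpha s _ (measurableC mV)
  (constant_off_shifts_setC _ _ _ cV) (pV (~` U)) cop approx mcV.
set J := [set j : 'I_n.+1 | _]%SET in h1.
have JC : [set j : 'I_n.+1 | `[< (~` V) (s + j%:R * alpha) >]]%SET = (~: J)%SET.
  by apply/setP => j; rewrite !inE asbool_neg.
rewrite JC in h2.
have cJ : #|J|%:R + #|~: J|%SET%:R = n.+1%:R :> R.
  by rewrite -natrD cardsC card_ord.
have -> : \sum_(j < n.+1) balanced_indic U (to_circle (s + j%:R * alpha)) =
    #|J|%:R - #|~: J|%SET%:R.
  under eq_bigr do rewrite balanced_indic_to_circle.
  rewrite (bigID (mem J)) /= -!sum1_card !natr_sum -sumrN; congr (_ + _).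
    by apply: eq_bigr => j; rewrite inE => ->.
  by apply: eq_big => [j|j]; rewrite !inE // => /negPf ->.
rewrite ler_norml; move: h1 h2; rewrite !natrM -cJ => h1 h2.
by apply/andP; split; lra.
Qed.

(** * Growth of the orbit sums *)

Lemma norm_sum_le_blocks (R : realType) (f : nat -> R) (q : nat) (C : R) :
  (0 < q)%N -> (forall n, `|f n| <= 1) ->
  (forall k, `|\sum_(j < q) f (k + j)%N| <= C) ->
  forall N, `|\sum_(0 <= n < N) f n| <= C * N%:R / q%:R + q%:R.
Proof.
move=> q0 f1 fq N.
have qR : 0 < q%:R :> R by rewrite ltr0n.
have C0 : 0 <= C by apply: le_trans (fq 0%N).
have blocks a : `|\sum_(0 <= n < a * q) f n| <= C * a%:R.
  elim: a => [|a IH]; first by rewrite mul0n big_geq // normr0 mulr0.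
  rewrite mulSn addnC (@big_cat_nat _ _ _ (a * q)%N) //= ?leq_addr //.
  rewrite -natr1 mulrDr mulr1; apply: le_trans (ler_normD _ _) _; apply: lerD => //.
  rewrite -{1}[(a * q)%N]add0n big_addn addKn big_mkord.
  by under eq_bigr do rewrite addnC.
rewrite [X in index_iota _ X](divn_eq N q).
rewrite (@big_cat_nat _ _ _ (N %/ q * q)%N) //= ?leq_addr //.
apply: le_trans (ler_normD _ _) _; apply: lerD.
  apply: le_trans (blocks _) _; rewrite -mulrA ler_wpM2l // ler_pdivlMr //.
  by rewrite -natrM ler_nat leq_divM.
apply: le_trans (ler_norm_sum _ _ _) _.
apply: le_trans (ler_sum _ (fun n _ => f1 n)) _.
by rewrite sumr_const_nat addKn -mulr_natl mulr1 ler_nat ltnW // ltn_pmod.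
Qed.

(** The failure of the Liouville property bounds the denominators [q >= 2]; the
    constant [A] absorbs [q = 1], where the distance from [alpha] to an integer is
    at least [min alpha (1 - alpha)]. *)
Lemma not_liouville_lower_bound (R : realType) (alpha : R) :
  0 < alpha < 1 -> irrational alpha -> ~ liouville alpha ->
  exists m A : nat, [/\ (0 < m)%N, (0 < A)%N & forall (q : nat) (p : int), (0 < q)%N ->
    (A%:R * q%:R ^+ m)^-1 <= `|q%:R * alpha - p%:~R|].
Proof.
move=> /andP[a0 a1] irr nL.
have [v v1 hv] : exists2 v : R, 1 <= v & forall p q : int, 2 <= q ->
    (q%:~R : R) `^ (- (v + 1)) <= `|alpha - p%:~R / q%:~R|.
  apply: contrapT => H; apply: nL; split=> // v v1; apply: contrapT => H2.
  apply: H; exists v => // p q q2; rewrite leNgt; apply/negP => h.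
  by apply: H2; exists p, q.
have nat_above (x : R) : 0 <= x -> exists2 n : nat, (0 < n)%N & x <= n%:R.
  by move=> /truncn_itv/andP[_ /ltW xn]; exists (Num.truncn x).+1.
have [m m0 vm] := nat_above v (le_trans ler01 v1).
pose c := alpha^-1 + (1 - alpha)^-1.
have b0 : 0 < 1 - alpha by lra.
have c0 : 0 < c by rewrite addr_gt0 // invr_gt0.
have [A A1 cA] := nat_above c (ltW c0).
exists m, A; split=> // q p q0.
have qR : 0 < q%:R :> R by rewrite ltr0n.
have A0 : 0 < A%:R :> R by rewrite ltr0n.
have [q1|q2] := leqP q 1.
  have -> : q = 1%N by lia.
  rewrite expr1n mulr1 mul1r.
  have [p0|p1] := lerP p 0.
    have pR : p%:~R <= 0 :> R by rewrite lerz0.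
    apply: (@le_trans _ _ alpha); last by rewrite ger0_norm; lra.
    rewrite -[leRHS]invrK lef_pV2 ?posrE ?invr_gt0 //.
    by apply: le_trans cA; rewrite /c lerDl invr_ge0 ltW.
  have pR : 1 <= p%:~R :> R by rewrite -[1]/(1%:~R) ler_int; lia.
  apply: (@le_trans _ _ (1 - alpha)); last by rewrite ler0_norm; lra.
  rewrite -[leRHS]invrK lef_pV2 ?posrE ?invr_gt0 //.
  by apply: le_trans cA; rewrite /c lerDr invr_ge0 ltW.
have /(hv p q%:Z) : 2 <= q%:Z by lia.
rewrite -pmulrn => h.
have -> : q%:R * alpha - p%:~R = q%:R * (alpha - p%:~R / q%:R).
  by field; rewrite gt_eqF.
rewrite normrM gtr0_norm // [leRHS]mulrC -ler_pdivrMr //.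
apply: le_trans h; rewrite -invfM.
apply: (@le_trans _ _ ((q%:R ^+ m.+1)^-1)).
  rewrite lef_pV2 ?posrE ?mulr_gt0 ?exprn_gt0 //.
  rewrite -mulrA -exprSr ler_peMl ?exprn_ge0 ?ler1n //.
have q1 : 1 <= q%:R :> R by rewrite ler1n.
rewrite -(powR_invn m.+1 (ler0n R q)); apply: ler_powR => //.
by rewrite lerN2 -natr1 lerD2r.
Qed.

(** Dirichlet's theorem at level [A K^m] gives a denominator [q <= A K^m], and the
    lower bound [1/(A q^m) <= |q alpha - p| < 1/(A K^m)] forces [q > K].  There are
    at most [N/K] complete blocks of length [q], and the incomplete one contributes
    at most [q <= A K^m <= A N/K]. *)
Lemma orbit_sum_growth (R : realType) (U : set (circle R)) (alpha : R) :
  finite_union_of_arcs U -> circle_measure U = (2^-1)%:E ->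
  0 < alpha < 1 -> irrational alpha -> ~ liouville alpha ->
  exists d B : nat, (0 < d)%N /\ forall (s : R) (K N : nat), (0 < K)%N -> (K ^ d <= N)%N ->
    `|\sum_(0 <= n < N) balanced_indic U (to_circle (s + n%:R * alpha))|
      <= B%:R * N%:R / K%:R.
Proof.
move=> arcs mU a01 irr /(not_liouville_lower_bound _ _ a01 irr)[m [A [m0 A0 lb]]].
have [C hC] := block_sum_bounded R U arcs mU.
exists m.+1, (C + A)%N; split=> // s K N K0 KN.
have Q0 : (0 < A * K ^ m)%N by rewrite muln_gt0 A0 expn_gt0 K0.
have [n [p [nQ cop approx]]] := dirichlet_approximation R alpha _ Q0.
have qR : 0 < n.+1%:R :> R by rewrite ltr0n.
have KR : 0 < K%:R :> R by rewrite ltr0n.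
have AR : 0 < A%:R :> R by rewrite ltr0n.
have Kq : (K < n.+1)%N.
  have := le_lt_trans (lb n.+1 p isT) approx.
  rewrite ltf_pV2 ?posrE ?ltr0n // ?mulr_gt0 ?exprn_gt0 //.
  by rewrite natrM natrX ltr_pM2l // ltr_pXn2r ?nnegrE ?ltW // ltr_nat.
have approx' : `|n.+1%:R * alpha - p%:~R| <= n.+1%:R^-1.
  apply: le_trans (ltW approx) _.
  by rewrite lef_pV2 ?posrE ?ltr0n // ler_nat.
pose f n := balanced_indic U (to_circle (s + n%:R * alpha)).
have blocks k : `|\sum_(j < n.+1) f (k + j)%N| <= C%:R.
  have := hC n p alpha (s + k%:R * alpha) cop approx'.
  by under eq_bigr do rewrite -addrA -mulrDl -natrD.
have f1 k : `|f k| <= 1 by rewrite norm_balanced_indic.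
apply: le_trans (norm_sum_le_blocks R f n.+1 C%:R isT f1 blocks N) _.
rewrite natrD !mulrDl; apply: lerD.
  by rewrite ler_wpM2l ?mulr_ge0 // lef_pV2 ?posrE // ler_nat ltnW.
rewrite ler_pdivlMr // -!natrM ler_nat.
apply: (@leq_trans (A * K ^ m * K)); first by rewrite leq_mul2r nQ orbT.
by rewrite -mulnA -expnSr leq_mul2l KN orbT.
Qed.

(** * Convergence with harmonic weights *)

Lemma nat_root_expn (R : realType) (d n : nat) : (0 < d)%N ->
  (n%:R `^ d%:R^-1 : R) ^+ d = n%:R.
Proof.
move=> d0; rewrite -powR_mulrn ?powR_ge0 // -powRrM mulVf ?powRr1 ?ler0n //.
by rewrite pnatr_eq0 -lt0n.
Qed.

Lemma inv_nat_root_cvg0 (R : realType) (d : nat) : (0 < d)%N ->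
  (n%:R `^ d%:R^-1 : R)^-1 @[n --> \oo] --> (0 : R).
Proof.
move=> d0; apply/cvgr0Pnorm_lt => e e0.
exists (Num.truncn (e^-1 ^+ d)).+1 => //= n /= hn.
have r0 : 0 <= n%:R `^ d%:R^-1 :> R by exact: powR_ge0.
rewrite ger0_norm ?invr_ge0 // invf_plt ?posrE //; last first.
  by rewrite powR_gt0 // ltr0n; lia.
rewrite -(ltr_pXn2r d0) ?nnegrE ?invr_ge0 ?(ltW e0) // nat_root_expn //.
have /andP[_ h] : (Num.truncn (e^-1 ^+ d))%:R <= e^-1 ^+ d < (Num.truncn (e^-1 ^+ d)).+1%:R.
  by apply: truncn_itv; rewrite exprn_ge0 // invr_ge0 ltW.
by apply: lt_le_trans h _; rewrite ler_nat.
Qed.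

(** With [x] and [y] the [d]-th roots of [n] and [n + 1], the factorization
    [1 = y^d - x^d <= d (y - x) y^(d-1)] bounds the gap [y - x] from below.  This
    compares terms of order [n^(-1-1/d)] with those of a telescoping series. *)
Lemma inv_nat_root_telescope (R : realType) (d n : nat) : (0 < d)%N -> (0 < n)%N ->
  (n.+1%:R * n%:R `^ d%:R^-1)^-1 <=
  d%:R * ((n%:R `^ d%:R^-1)^-1 - (n.+1%:R `^ d%:R^-1)^-1) :> R.
Proof.
move=> d0 n0; set x := n%:R `^ _; set y := n.+1%:R `^ _.
have xd : x ^+ d = n%:R by exact: nat_root_expn.
have yd : y ^+ d = n.+1%:R by exact: nat_root_expn.
have x0 : 0 < x by rewrite powR_gt0 // ltr0n.
have y0 : 0 < y by rewrite powR_gt0 // ltr0n.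
have xy : x <= y.
  by apply: ge0_ler_powR; rewrite ?nnegrE ?invr_ge0 ?ler0n // ler_nat.
have gap : 1 <= d%:R * (y - x) * y ^+ d.-1.
  have {1}-> : 1 = y ^+ d - x ^+ d by rewrite xd yd -natr1; ring.
  rewrite subrXX -[leRHS]mulrA [leRHS]mulrCA; apply: ler_wpM2l; first by rewrite subr_ge0.
  have -> : d%:R * y ^+ d.-1 = \sum_(i < d) y ^+ d.-1 by rewrite sumr_const card_ord mulr_natl.
  apply: ler_sum => i _.
  have id : (i <= d.-1)%N by have := ltn_ord i; lia.
  rewrite -[in leRHS](subnK id) exprD ler_wpM2l ?exprn_ge0 ?(ltW y0) //.
  by rewrite lerXn2r ?nnegrE ?(ltW x0) ?(ltW y0).
have -> : x^-1 - y^-1 = (y - x) / (x * y) by field; rewrite !gt_eqF.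
rewrite -yd mulrA ler_pdivlMr ?mulr_gt0 // invfM.
have -> : (y ^+ d)^-1 * x^-1 * (x * y) = (y ^+ d.-1)^-1.
  rewrite -[in LHS](prednK d0) exprSr; field.
  by rewrite !gt_eqF // exprn_gt0.
by rewrite -[leLHS]mul1r ler_pdivrMr ?exprn_gt0.
Qed.

Lemma harmonic_abel_summation (R : realType) (a : nat -> R) (N : nat) :
  \sum_(1 <= n < N.+1) a n / n%:R =
  \sum_(0 <= n < N) (\sum_(1 <= i < n.+2) a i) / (n.+1%:R * n.+2%:R) +
  (\sum_(1 <= i < N.+1) a i) / N.+1%:R.
Proof.
elim: N => [|N IH]; first by rewrite !big_geq // mul0r addr0.
rewrite big_nat_recr //= IH [in RHS]big_nat_recr //=.
rewrite [\sum_(1 <= i < N.+2) a i]big_nat_recr //=.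
set S := \sum_(1 <= i < N.+1) a i; set T := \sum_(0 <= n < N) _.
rewrite -[N.+2%:R]natr1; field.
by rewrite nat1r natr1 !pnatr_eq0.
Qed.

(** Taking for [K] the integer part of [N^(1/d)] bounds the partial sums by
    [2 B N^(1-1/d)].  After Abel summation the boundary term tends to [0] and the
    remaining series is dominated by a telescoping one. *)
Lemma cvg_harmonic_weighted_sum (R : realType) (a : nat -> R) (d : nat) (B : R) :
  (0 < d)%N ->
  (forall K N : nat, (0 < K)%N -> (K ^ d <= N)%N ->
     `|\sum_(1 <= n < N.+1) a n| <= B * N%:R / K%:R) ->
  cvgn (fun N => \sum_(1 <= n < N.+1) a n / n%:R).
Proof.
move=> d0 hS; pose S N := \sum_(1 <= n < N.+1) a n.
pose r n : R := n%:R `^ d%:R^-1.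
have r0 n : (0 < n)%N -> 0 < r n by move=> n0; rewrite powR_gt0 // ltr0n.
have B0 : 0 <= B.
  by have := hS 1%N 1%N isT; rewrite exp1n => /(_ isT); rewrite mulr1 divr1; apply: le_trans.
have bound n : (0 < n)%N -> `|S n| <= 2 * B * n%:R / r n.
  move=> n0; have /andP[K1 K2] := truncn_itv (ltW (r0 n n0)).
  set K := Num.truncn (r n) in K1 K2.
  have r1 : 1 <= r n.
    by rewrite -(ler_pXn2r d0) ?nnegrE ?(ltW (r0 n n0)) // expr1n nat_root_expn // ler1n.
  have K0 : (0 < K)%N by rewrite /K truncn_gt0.
  apply: le_trans (hS K n K0 _) _.
    rewrite -(ler_nat R) natrX -(nat_root_expn R d n d0).
    by rewrite ler_pXn2r ?nnegrE ?(ltW (r0 n n0)).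
  rewrite [2 * B]mulrC -!mulrA ler_wpM2l // [leLHS]mulrC [2 * _]mulrCA -[leRHS]mulrC.
  rewrite ler_wpM2r // ler_pdivlMr ?r0 // mulrC ler_pdivrMr ?ltr0n //.
  have : 1 <= K%:R :> R by rewrite ler1n.
  by move: K2; rewrite -natr1; lra.
have boundary : (fun N => S N / N.+1%:R) @ \oo --> (0 : R).
  apply: norm_cvg0.
  apply: (squeeze_cvgr (f := fun=> 0) (h := fun n => 2 * B * (r n)^-1)).
  - exists 1%N => //= n /= n0; rewrite normr_ge0 /= normrM.
    rewrite [X in _ * X]gtr0_norm ?invr_gt0 ?ltr0n //.
    rewrite ler_pdivrMr ?ltr0n //; apply: le_trans (bound n n0) _.
    rewrite -!mulrA !ler_wpM2l // [leRHS]mulrC ler_wpM2r ?invr_ge0 ?ler_nat //.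
    exact: ltW (r0 n n0).
  - exact: cvg_cst.
  - rewrite -[X in _ --> X](mulr0 (2 * B)); apply: cvgMr.
    exact: inv_nat_root_cvg0.
have -> : (fun N => \sum_(1 <= n < N.+1) a n / n%:R) =
  series (fun n => S n.+1 / (n.+1%:R * n.+2%:R)) \+ (fun N => S N / N.+1%:R).
  by apply/funext => N; rewrite harmonic_abel_summation.
apply: is_cvgD; last exact: (cvgP _ boundary).
apply: normed_cvg.
apply: (@series_le_cvg _ _ (fun n => 2 * B * d%:R * ((r n.+1)^-1 - (r n.+2)^-1))).
- by move=> n; exact: normr_ge0.
- move=> n; rewrite !mulr_ge0 // subr_ge0 lef_pV2 ?posrE ?r0 //.
  by apply: ge0_ler_powR; rewrite ?nnegrE ?invr_ge0 ?ler0n // ler_nat.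
- move=> n /=; rewrite normrM [X in _ * X]gtr0_norm ?invr_gt0 ?mulr_gt0 ?ltr0n //.
  apply: (@le_trans _ _ (2 * B * (n.+2%:R * r n.+1)^-1)); last first.
    by rewrite -[leRHS]mulrA ler_wpM2l ?mulr_ge0 // inv_nat_root_telescope.
  rewrite ler_pdivrMr ?mulr_gt0 ?ltr0n //; apply: le_trans (bound n.+1 isT) _.
  rewrite le_eqVlt; apply/orP; left; apply/eqP; field.
  by rewrite -natrD pnatr_eq0 andbT gt_eqF ?r0.
have -> : series (fun n => 2 * B * d%:R * ((r n.+1)^-1 - (r n.+2)^-1)) =
    (fun n => 2 * B * d%:R * ((r 1%N)^-1 - (r n.+1)^-1)).
  apply/funext => n; rewrite /series /= -mulr_sumr; congr (_ * _).
  elim: n => [|n IH]; first by rewrite big_geq // subrr.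
  by rewrite big_nat_recr //= IH; ring.
have tail : (r n.+1)^-1 @[n --> \oo] --> (0 : R).
  have := inv_nat_root_cvg0 R d d0; rewrite -(cvg_shiftn 1%N) /=.
  by under eq_fun do rewrite addn1.
by apply: is_cvgMr; apply: is_cvgB; [exact: is_cvg_cst | exact: (cvgP _ tail)].
Qed.

Lemma cvg_rotation_sums (R : realType) (U : set (circle R)) (x : circle R) (alpha : R) :
  finite_union_of_arcs U -> circle_measure U = (2^-1)%:E ->
  0 < alpha < 1 -> irrational alpha -> ~ liouville alpha ->
  cvgn (rotation_sums U x alpha).
Proof.
move=> arcs mU a01 irr nL.
have [d [B [d0 growth]]] := orbit_sum_growth R U alpha arcs mU a01 irr nL.
have [t <-] := to_circle_surj R x.
apply: (cvg_harmonic_weighted_sum R _ d B%:R d0) => K N K0 KN.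
rewrite big_add1 /=.
rewrite (eq_bigr (fun n => balanced_indic U (to_circle (t + alpha + n%:R * alpha)))).
  exact: growth.
by move=> n _; rewrite -to_circleD -natr1 mulrDl mul1r addrAC addrA.
Qed.

(** * Hausdorff measures and covers *)

Lemma ereal_inf_nonneg (R : realType) (T : Type) (P : set T) (f : T -> \bar R) :
  (forall x, P x -> 0 <= f x)%E -> (0 <= ereal_inf [set f x | x in P])%E.
Proof. by move=> f0; apply: le_ereal_inf_tmp => _ [x Px <-]; exact: f0. Qed.

Lemma diam_pow_ge0 (R : realType) (s : R) (E : set R) : (0 <= diam_pow s E)%E.
Proof. by rewrite /diam_pow; case: ifP => // _; exact: poweR_ge0. Qed.

Lemma hausdorff_content_ge0 (R : realType) (s delta : R) (A : set R) :
  (0 <= hausdorff_content s delta A)%E.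
Proof.
by apply: ereal_inf_nonneg => F _; apply: nneseries_ge0 => i _ _; exact: diam_pow_ge0.
Qed.

Lemma diameter_le (R : realType) (E : set R) (D : R) : 0 <= D ->
  (forall x y, E x -> E y -> `|x - y| <= D) -> (diameter E <= D%:E)%E.
Proof.
move=> D0 h; rewrite /diameter ge_max lee_fin D0 /=.
by apply: ge_ereal_sup => _ [[x y] /= [Ex Ey] <-]; rewrite lee_fin h.
Qed.

Lemma diam_pow_le (R : realType) (s : R) (E : set R) (D : R) : 0 <= s ->
  (diameter E <= D%:E)%E -> (diam_pow s E <= (D `^ s)%:E)%E.
Proof.
move=> s0 ED; rewrite /diam_pow; case: ifP => _; first by rewrite lee_fin powR_ge0.
have E0 : (0 <= diameter E)%E by rewrite /diameter le_max lexx.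
rewrite -poweR_EFin; apply: gt0_ler_poweR => //; rewrite in_itv /= leey andbT //.
exact: le_trans ED.
Qed.

Lemma hausdorff_measure_eq0 (R : realType) (s : R) (A : set R) :
  (forall delta eps : R, 0 < delta -> 0 < eps -> exists F : (set R)^nat,
     [/\ A `<=` \bigcup_i F i, forall i, (diameter (F i) <= delta%:E)%E &
         (\sum_(0 <= i <oo) diam_pow s (F i) <= eps%:E)%E]) ->
  hausdorff_measure s A = 0%E.
Proof.
move=> cover; apply/eqP; rewrite eq_le; apply/andP; split.
  apply: ge_ereal_sup => _ [delta /= delta0 <-].
  apply/lee_addgt0Pr => eps eps0; rewrite add0e.
  have [F [AF Fd Fs]] := cover delta eps delta0 eps0.
  by apply: le_trans Fs; apply: ereal_inf_lbound; exists F.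
apply: le_trans (hausdorff_content_ge0 R s 1 A) _.
by apply: ereal_sup_ubound; exists 1 => //=.
Qed.

Lemma hausdorff_dim_eq0 (R : realType) (A : set R) :
  (forall s : R, 0 < s -> hausdorff_measure s A = 0%E) -> hausdorff_dim A = 0%E.
Proof.
move=> h; apply/eqP; rewrite eq_le; apply/andP; split.
  apply/lee_addgt0Pr => eps eps0; rewrite add0e.
  by apply: ereal_inf_lbound; exists eps => //=; split; [exact: ltW | exact: h].
by apply: ereal_inf_nonneg => s /= [s0 _]; rewrite lee_fin.
Qed.

(** * The Liouville numbers *)

(** Induction on the bound [2 c - c/N] for the partial sums. *)
Lemma nneseries_inv_square_le (R : realType) (u : (\bar R)^nat) (c : R) : 0 <= c ->
  (forall i, 0 <= u i)%E -> (forall i, u i <= (c / i.+1%:R ^+ 2)%:E)%E ->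
  (\sum_(0 <= i <oo) u i <= (2 * c)%:E)%E.
Proof.
move=> c0 u0 uc; apply: lime_le; first exact: is_cvg_nneseries.
apply: nearW => N.
apply: (@le_trans _ _ (\sum_(0 <= i < N) (c / i.+1%:R ^+ 2)%:E)%E).
  by apply: lee_sum => i _; exact: uc.
rewrite sumEFin lee_fin.
suff : \sum_(0 <= i < N.+1) c / i.+1%:R ^+ 2 <= 2 * c - c / N.+1%:R.
  rewrite big_nat_recr //= => h.
  have : 0 <= c / N.+1%:R ^+ 2 by rewrite divr_ge0 ?exprn_ge0.
  have : 0 <= c / N.+1%:R by rewrite divr_ge0.
  by move: h; move: (\sum_(0 <= i < N) _) (c / _ ^+ 2) (c / N.+1%:R) => x y z; lra.
elim: N => [|N IH]; first by rewrite big_nat1 expr1n divr1; lra.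
rewrite big_nat_recr //=; apply: le_trans (lerD IH (lexx _)) _.
have N0 : 0 < N.+1%:R :> R by rewrite ltr0n.
rewrite -[N.+2%:R]natr1; set x := N.+1%:R in N0 *.
have -> : 2 * c - c / (x + 1) = 2 * c - c / x + c / (x * (x + 1)).
  by field; rewrite !gt_eqF // addr_gt0.
rewrite lerD2l ler_wpM2l // lef_pV2 ?posrE ?mulr_gt0 ?exprn_gt0 ?addr_gt0 //.
by rewrite expr2 ler_pM2r ?addr_gt0 // lerDl.
Qed.

(** The balls of radius [q^-n] around the rationals [p/q], numbered by
    [i = q^2 + p].  Since [0 <= p <= q] this number determines [(q, p)], and it is
    polynomially bounded in [q]; a number [i] not of this form gets the empty
    set. *)
Definition rational_ball (R : realType) (n i : nat) : set R :=
  [set a | exists q p : nat, [/\ (2 <= q)%N, (p <= q)%N, i = (q ^ 2 + p)%N &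
     `|a - p%:R / q%:R| < q%:R ^- n]].

(** The Liouville condition with exponent [v = n - 1] gives the ball; as its radius
    is at most [1/q], a centre approximating a number of [(0,1)] has
    [0 <= p <= q]. *)
Lemma liouville_sub_rational_balls (R : realType) (n : nat) (alpha : R) :
  (2 <= n)%N -> 0 < alpha < 1 -> liouville alpha ->
  (\bigcup_i rational_ball R n i) alpha.
Proof.
move=> n2 /andP[a0 a1] [_ /(_ n.-1%:R)].
rewrite ler1n natr1 prednK; last by lia.
have n1 : (0 < n.-1)%N by lia.
move=> /(_ n1) [p [q [q2 hpq]]].
have [Q hQ] : exists Q : nat, q = Q by exists `|q|%N; lia.
have Q2 : (2 <= Q)%N by lia.
have QR : 0 < Q%:R :> R by rewrite ltr0n; lia.
have Q1 : 1 <= Q%:R :> R by rewrite ler1n; lia.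
have {}hpq : `|alpha - p%:~R / Q%:R| < Q%:R ^- n.
  by move: hpq; rewrite hQ -pmulrn powR_invn.
have near1 : `|Q%:R * alpha - p%:~R| < 1.
  have -> : Q%:R * alpha - p%:~R = Q%:R * (alpha - p%:~R / Q%:R).
    by field; rewrite gt_eqF.
  rewrite normrM gtr0_norm // mulrC -ltr_pdivlMr // mul1r.
  apply: lt_le_trans hpq _; rewrite lef_pV2 ?posrE ?exprn_gt0 //.
  by apply: ler_eXnr => //; lia.
have p0 : -1 < p.
  rewrite -(ltr_int R) rmorphN1.
  by move: near1; rewrite ltr_norml => /andP[_]; have := mulr_gt0 QR a0; lra.
have pQ : p < Q%:Z + 1.
  rewrite -(ltr_int R) intrD -pmulrn.
  move: near1; rewrite ltr_norml => /andP[]; have : Q%:R * alpha < Q%:R by rewrite gtr_pMr.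
  by lra.
have [P hP] : exists P : nat, p = P by exists `|p|%N; lia.
rewrite hP in p0 pQ hpq.
exists (Q ^ 2 + P)%N => //; exists Q, P; split=> //; first by lia.
Qed.

Lemma rational_ball_diameter (R : realType) (n i q p : nat) :
  (2 <= q)%N -> (p <= q)%N -> i = (q ^ 2 + p)%N ->
  (diameter (rational_ball R n i) <= (2 * q%:R ^- n)%:E)%E.
Proof.
move=> q2 pq hi; apply: diameter_le; first by rewrite mulr_ge0 // invr_ge0 exprn_ge0.
move=> x y [q1 [p1 [q12 pq1 hi1 hx]]] [q2' [p2 [q22 pq2 hi2 hy]]].
have e1 : q1 = q by nia.
have e2 : q2' = q by nia.
subst q1 q2'.
have e : p1 = p2 by lia.
subst p2; move: hx hy; rewrite !ltr_norml => /andP[? ?] /andP[? ?].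
by rewrite ler_norml; apply/andP; split; lra.
Qed.

Lemma rational_ball_index (R : realType) (n i : nat) :
  rational_ball R n i = set0 \/
  exists q p : nat, [/\ (2 <= q)%N, (p <= q)%N & i = (q ^ 2 + p)%N].
Proof.
have [->|/set0P[a [q [p [q2 pq hi _]]]]] := eqVneq (rational_ball R n i) set0; [by left|].
by right; exists q, p.
Qed.

(** The [s]-th power of the diameter of the [i]-th ball is at most
    [2^s q^(-n s)], and [i + 1 <= q^4].  For [n s >= 8 + M] it is thus at most
    [2^s 2^-M / (i + 1)^2], and [M] is free. *)
Lemma hausdorff_measure_liouville_subset (R : realType) (s : R) (A : set R) : 0 < s ->
  A `<=` [set alpha | 0 < alpha < 1 /\ liouville alpha] ->
  hausdorff_measure s A = 0%E.
Proof.
move=> s0 sub; apply: hausdorff_measure_eq0 => delta eps delta0 eps0.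
have small_pow (c : R) : 0 < c -> exists M : nat, 2 ^- M <= c.
  move=> c0; exists (Num.truncn c^-1).+1.
  rewrite -[leRHS]invrK lef_pV2 ?posrE ?invr_gt0 ?exprn_gt0 //.
  have /andP[_ /ltW h] : (Num.truncn c^-1)%:R <= c^-1 < (Num.truncn c^-1).+1%:R.
    by apply: truncn_itv; rewrite invr_ge0 ltW.
  by apply: le_trans h _; rewrite -natrX ler_nat ltnW // ltn_expl.
have [M hM] : exists M : nat, 2 ^- M <= eps / 2 / 2 `^ s.
  by apply: small_pow; rewrite !divr_gt0 // powR_gt0.
have [n1 hn1] : exists n1 : nat, (8 + M)%:R <= n1%:R * s.
  exists (Num.truncn ((8 + M)%:R / s)).+1; rewrite -ler_pdivrMr // ltW //.
  by have /andP[] := truncn_itv (divr_ge0 (ler0n R (8 + M)) (ltW s0)).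
have [n2 hn2] : exists n2 : nat, 2 ^- n2 <= delta / 2.
  by apply: small_pow; rewrite divr_gt0.
pose n := (2 + n1 + n2)%N.
exists (rational_ball R n); split.
- move=> alpha /sub /= [a01 La]; exact: liouville_sub_rational_balls.
- move=> i; have [->|[q [p [q2 pq hi]]]] := rational_ball_index R n i.
    by apply: diameter_le => //; exact: ltW.
  apply: le_trans (rational_ball_diameter R n i q p q2 pq hi) _.
  rewrite lee_fin mulrC -ler_pdivlMr //; apply: le_trans hn2.
  have qR : 0 < q%:R :> R by rewrite ltr0n; lia.
  rewrite lef_pV2 ?posrE ?exprn_gt0 // -!natrX ler_nat.
  apply: (@leq_trans (2 ^ n)); first by rewrite leq_exp2l // /n; lia.
  by rewrite leq_exp2r // /n; lia.
have -> : eps = 2 * (eps / 2) by field.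
apply: nneseries_inv_square_le => [|i|i]; [by rewrite divr_ge0 ?ltW| exact: diam_pow_ge0|].
have [->|[q [p [q2 pq hi]]]] := rational_ball_index R n i.
  by rewrite /diam_pow eqxx lee_fin !divr_ge0 ?exprn_ge0 // ltW.
apply: le_trans (diam_pow_le R s _ _ (ltW s0) (rational_ball_diameter R n i q p q2 pq hi)) _.
have q1 : 1 <= q%:R :> R by rewrite ler1n; lia.
have qR : 0 < q%:R :> R by rewrite ltr0n; lia.
rewrite lee_fin powRM ?invr_ge0 ?exprn_ge0 // -powR_invn // -powRrM.
apply: (@le_trans _ _ (2 `^ s * q%:R ^- (8 + M))).
  rewrite ler_wpM2l ?powR_ge0 // -powR_invn //; apply: ler_powR => //.
  rewrite mulNr lerN2; apply: le_trans hn1 _.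
  by rewrite ler_wpM2r ?(ltW s0) // ler_nat /n; lia.
rewrite mulrC -ler_pdivlMr ?powR_gt0 // exprD invfM.
rewrite [leRHS]mulrAC mulrC; apply: ler_pM; rewrite ?invr_ge0 ?exprn_ge0 //.
  apply: le_trans hM; rewrite lef_pV2 ?posrE ?exprn_gt0 //.
  by rewrite lerXn2r ?nnegrE // ?ler_nat.
rewrite lef_pV2 ?posrE ?exprn_gt0 ?ltr0n //; last by lia.
rewrite -!natrX ler_nat hi.
by rewrite (_ : 8 = 4 * 2)%N // expnM leq_exp2r //; nia.
Qed.

Theorem theorem2 (R : realType) :
  (forall alpha : R, 0 < alpha < 1 -> irrational alpha ->
     (exists (U : set (circle R)) (x : circle R),
        [/\ finite_union_of_arcs U,
            circle_measure U = (2^-1)%:E &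
            ~ cvgn (rotation_sums U x alpha)]) ->
     liouville alpha) /\
  hausdorff_dim
    [set alpha : R | [/\ 0 < alpha < 1, irrational alpha &
       exists (U : set (circle R)) (x : circle R),
         [/\ finite_union_of_arcs U,
             circle_measure U = (2^-1)%:E &
             ~ cvgn (rotation_sums U x alpha)]]] = 0%E.
Proof.
have div_liouville (alpha : R) : 0 < alpha < 1 -> irrational alpha ->
    (exists (U : set (circle R)) (x : circle R),
       [/\ finite_union_of_arcs U, circle_measure U = (2^-1)%:E &
           ~ cvgn (rotation_sums U x alpha)]) -> liouville alpha.
  move=> a01 irr [U [x [arcs mU ncv]]]; apply: contrapT => nL; apply: ncv.
  exact: cvg_rotation_sums.
split=> //; apply: hausdorff_dim_eq0 => s s0.
apply: hausdorff_measure_liouville_subset => // alpha /= [a01 irr div].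
by split=> //; exact: div_liouville.
Qed.
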